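(* Let $D$ be a finite distributive lattice. Then there exists a finite atomistic lattice $L$ such that $\mathrm{Con}\,L\cong D$ and $$|\mathrm{J}(D)|\leq|\mathrm{J}(L)|\leq\tfrac{5}{3}|\mathrm{J}(D)|.$$ Furthermore, the constant $5/3$ in this inequality is best possible; that is, for every real number $k<5/3$ there exists a finite distributive lattice $D$ such that no finite atomistic lattice $L$ with $\mathrm{Con}\,L\cong D$ satisfies $|\mathrm{J}(L)|\leq k\,|\mathrm{J}(D)|$.
   Context: For a finite lattice $L$, $\mathrm{J}(L)$ denotes the set of all (nonzero) join-irreducible elements of $L$, and $\mathrm{Con}\,L$ is the congruence lattice of $L$. A finite lattice is atomistic if every element is a (finite, possibly empty) join of atoms. *)

(* Defs.v *)
From HB Require Import structures.
From mathcomp Require Import all_boot all_order all_algebra.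
From mathcomp Require Import reals.

Set Implicit Arguments.
Unset Strict Implicit.
Unset Printing Implicit Defensive.

Import Order.TTheory.
Local Open Scope order_scope.

(* Binary relations on L are represented by their graphs, so that the
   congruences form a finite type, ordered by inclusion. *)
Section Congruence.
Context {d : Order.disp_t} {L : finLatticeType d}.
Implicit Types r s : {set L * L}.

Definition congruence r : bool :=
  [&& [forall x, (x, x) \in r],
      [forall x, forall y, ((x, y) \in r) ==> ((y, x) \in r)],
      [forall x, forall y, forall z,
         ((x, y) \in r) ==> ((y, z) \in r) ==> ((x, z) \in r)],
      [forall x, forall y, forall z, forall t,
         ((x, y) \in r) ==> ((z, t) \in r) ==> ((x `&` z, y `&` t) \in r)]
    & [forall x, forall y, forall z, forall t,
         ((x, y) \in r) ==> ((z, t) \in r) ==> ((x `|` z, y `|` t) \in r)]].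

Lemma congruenceP r :
  reflect
    [/\ forall x, (x, x) \in r,
        forall x y, (x, y) \in r -> (y, x) \in r,
        forall x y z, (x, y) \in r -> (y, z) \in r -> (x, z) \in r,
        forall x y z t, (x, y) \in r -> (z, t) \in r ->
          (x `&` z, y `&` t) \in r
      & forall x y z t, (x, y) \in r -> (z, t) \in r ->
          (x `|` z, y `|` t) \in r]
    (congruence r).
Proof.
apply: (iffP and5P) => [[R S T M J] | [R S T M J]]; split.
- exact/forallP.
- by move=> x y; move/forallP/(_ x)/forallP/(_ y)/implyP: S.
- move=> x y z xy yz.
  by move/forallP/(_ x)/forallP/(_ y)/forallP/(_ z): T; rewrite xy yz.
- move=> x y z t xy zt.
  by move/forallP/(_ x)/forallP/(_ y)/forallP/(_ z)/forallP/(_ t): M;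
    rewrite xy zt.
- move=> x y z t xy zt.
  by move/forallP/(_ x)/forallP/(_ y)/forallP/(_ z)/forallP/(_ t): J;
    rewrite xy zt.
- exact/forallP.
- by apply/forallP => x; apply/forallP => y; apply/implyP/S.
- apply/forallP => x; apply/forallP => y; apply/forallP => z.
  by apply/implyP => xy; apply/implyP; exact: T xy.
- do 4 (apply/forallP => ?).
  by apply/implyP => xy; apply/implyP; exact: M xy.
- do 4 (apply/forallP => ?).
  by apply/implyP => xy; apply/implyP; exact: J xy.
Qed.

Lemma congruence_bigcap (P : pred {set L * L}) :
  (forall r, P r -> congruence r) -> congruence (\bigcap_(r | P r) r).
Proof.
move=> PC; apply/congruenceP; split.
- by move=> x; apply/bigcapP => r /PC/congruenceP[].
- move=> x y /bigcapP xy; apply/bigcapP => r Pr.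
  by have /congruenceP[_ S _ _ _] := PC r Pr; apply/S/xy.
- move=> x y z /bigcapP xy /bigcapP yz; apply/bigcapP => r Pr.
  by have /congruenceP[_ _ T _ _] := PC r Pr; apply: T (xy r Pr) (yz r Pr).
- move=> x y z t /bigcapP xy /bigcapP zt; apply/bigcapP => r Pr.
  by have /congruenceP[_ _ _ M _] := PC r Pr; apply: M (xy r Pr) (zt r Pr).
- move=> x y z t /bigcapP xy /bigcapP zt; apply/bigcapP => r Pr.
  by have /congruenceP[_ _ _ _ J] := PC r Pr; apply: J (xy r Pr) (zt r Pr).
Qed.

Lemma congruenceI r s : congruence r -> congruence s -> congruence (r :&: s).
Proof.
move=> Cr Cs; have -> : r :&: s = \bigcap_(u | (u == r) || (u == s)) u.
  apply/setP => x; rewrite inE; apply/andP/bigcapP => [[xr xs] u|H].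
    by case/orP => /eqP->.
  by split; apply: H; rewrite eqxx ?orbT.
by apply: congruence_bigcap => u /orP[] /eqP->.
Qed.

Definition congruence_join r s : {set L * L} :=
  \bigcap_(u : {set L * L} | [&& congruence u, r \subset u & s \subset u]) u.

Lemma congruence_joinP r s : congruence (congruence_join r s).
Proof. by apply: congruence_bigcap => u /and3P[]. Qed.

Lemma congruence0 : congruence [set u : L * L | u.1 == u.2].
Proof.
apply/congruenceP; split => [x|x y|x y z|x y z t|x y z t]; rewrite !inE //=.
- by rewrite eq_sym.
- by move=> /eqP->.
- by move=> /eqP-> /eqP->.
- by move=> /eqP-> /eqP->.
Qed.

Lemma congruenceT : congruence [set: L * L].
Proof. by apply/congruenceP; split=> *; rewrite inE. Qed.

End Congruence.

Record con (d : Order.disp_t) (L : finLatticeType d) := Con {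
  con_rel :> {set L * L};
  con_relP : congruence con_rel
}.

HB.instance Definition _ (d : Order.disp_t) (L : finLatticeType d) :=
  [isSub for @con_rel d L].
HB.instance Definition _ (d : Order.disp_t) (L : finLatticeType d) :=
  [Finite of con L by <:].

Fact con_display : Order.disp_t. Proof. exact: Order.Disp tt tt. Qed.

Section ConLattice.
Context {d : Order.disp_t} {L : finLatticeType d}.
Implicit Types r s t : con L.

Definition con_le r s : bool := (r : {set L * L}) \subset s.

Fact con_le_refl : reflexive con_le.
Proof. by move=> r; exact: subxx. Qed.
Fact con_le_anti : antisymmetric con_le.
Proof. by move=> r s; rewrite /con_le -eqEsubset => /eqP/val_inj. Qed.
Fact con_le_trans : transitive con_le.
Proof. by move=> s r t; exact: subset_trans. Qed.

HB.instance Definition _ := Order.Le_isPOrder.Build con_display (con L)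
  con_le_refl con_le_anti con_le_trans.

Definition con_meet r s : con L := Con (congruenceI (con_relP r) (con_relP s)).
Definition con_join r s : con L := Con (congruence_joinP r s).

Fact con_meetP r s t : (r <= con_meet s t) = (r <= s) && (r <= t).
Proof. exact: subsetI. Qed.
Fact con_joinP r s t : (con_join r s <= t) = (r <= t) && (s <= t).
Proof.
apply/idP/andP => [H|[rt st]]; last first.
  by apply: bigcap_inf; apply/and3P; split=> //; exact: con_relP.
by split; apply: subset_trans H; apply/bigcapsP => u /and3P[].
Qed.

HB.instance Definition _ := Order.POrder_MeetJoin_isLattice.Build con_display
  (con L) con_meetP con_joinP.

Fact con_le0 r : Con congruence0 <= r.
Proof.
apply/subsetP => -[x y]; rewrite inE /= => /eqP->.
by have /congruenceP[] := con_relP r.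
Qed.
Fact con_le1 r : r <= Con congruenceT.
Proof. exact: subsetT. Qed.

HB.instance Definition _ := Order.hasBottom.Build con_display (con L) con_le0.
HB.instance Definition _ := Order.hasTop.Build con_display (con L) con_le1.

End ConLattice.

Definition lattice_iso (d d' : Order.disp_t)
    (L : latticeType d) (M : latticeType d') : Prop :=
  exists f : L -> M, [/\ bijective f,
    {morph f : x y / x `&` y} & {morph f : x y / x `|` y}].

(* A finite lattice is nonempty, hence bounded: finTBLatticeType, in which
   \bot = \top is allowed (the one-element lattice). *)
Section JoinIrreducible.
Context {d : Order.disp_t}.

Definition join_irreducible {L : finTBLatticeType d} (x : L) : bool :=
  (x != \bot) &&
  [forall a, forall b, (x == a `|` b) ==> (x == a) || (x == b)].

Definition J (L : finTBLatticeType d) : {set L} :=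
  [set x : L | join_irreducible x].

Definition atom {L : finTBLatticeType d} (a : L) : bool :=
  (\bot < a) && [forall b : L, (b < a) ==> (b == \bot)].

Definition atomistic (L : finTBLatticeType d) : Prop :=
  forall x : L, exists2 A : {set L},
    {in A, forall a, atom a} & x = \join_(a in A) a.

End JoinIrreducible.

(* Main.v *)
From HB Require Import structures.
Require Import Defs.
From mathcomp Require Import all_boot all_order all_algebra.
From mathcomp Require Import reals zify lra.

Set Implicit Arguments.
Unset Strict Implicit.
Unset Printing Implicit Defensive.

Import Order.TTheory GRing.Theory Num.Theory.

(** A congruence of a finite atomistic lattice L is determined by the set of
    atoms that it collapses to the bottom. The sets S of atoms so obtained are
    the _removable_ ones: whenever an atom outside S lies below a join of
    atoms, it still lies below that join after the members of S have been
    deleted ([collapsed_removable], [collapsed_con_of], [collapsed_le]).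
    Moreover J L is the set of atoms ([J_atomistic]). Both halves of the
    statement are thus about removable sets.

    Upper bound. Let Q be a finite multiset with support J D, and call a subset
    of Q closed when it contains p as soon as it contains two distinct elements
    that are >= p in D. Singletons are closed, so the closed sets form an
    atomistic lattice with atom set Q. A down-set of Q is removable; conversely
    a removable set is a down-set provided that, for all p <= q distinct in Q,
    there is a third element r >= p of Q, because then p is below the join of
    q and r but not below r. Under this proviso the congruence lattice is that
    of the down-sets of J D, that is, D ([con_closed_set_iso]). It remains to
    choose multiplicities such that no element of Q has exactly two elements
    of Q above it, itself included. The only obstructions are the p in J D
    having a single element m of J D strictly above them. If m is this element
    for one p only, p is doubled; if it is so for c >= 2 elements, m is tripled.
    So at most one copy is added for the pair {p, m}, and at most two for the
    c + 1 >= 3 elements attached to m, whence at most (2/3)|J D| extra copies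
    ([sum_copies], [copies_third]).

    Lower bound. Let D be the square with a new top added: J D has 3 elements,
    the two atoms a, b of the square below the top. Suppose that Con L is
    isomorphic to D, and let A, B, T be the sets of atoms of L that are
    collapsed by a, collapsed by b, and not collapsed by a \/ b. They partition
    the atoms, since a union of removable sets is removable. If S is removable
    and at most two atoms, one of which is p, are outside S, then the
    complement of p is removable ([removable_prime]); the corresponding
    congruence is not the top one, hence it is below a \/ b, and T is contained
    in {p}. For S = A \cup B this gives |T| <> 2; for S = B (and p in A)
    or S = A (and p in B) it gives |A| + |T| >= 3 and |B| + |T| >= 3. These
    inequalities imply |A| + |B| + |T| >= 5, as A, B and T are nonempty
    ([card_atoms_peaked]). *)

(** * Atoms of a finite atomistic lattice *)

Section Atoms.
Local Open Scope order_scope.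
Context {d : Order.disp_t} {L : finTBLatticeType d}.
Implicit Types (a p x y : L) (X S : {set L}).

Definition atoms : {set L} := [set a : L | atom a].

Lemma atom_meet a x : atom a -> ~~ (a <= x) -> a `&` x = \bot.
Proof.
case/andP=> _ /forallP/(_ (a `&` x))/implyP H nax; apply/eqP/H.
by rewrite lt_neqAle leIl andbT; apply: contraNneq nax => <-; exact: leIr.
Qed.

Lemma atom_neq0 a : atom a -> a != \bot.
Proof. by case/andP=> /gt_eqF->. Qed.

Lemma atom_le_eq a b : atom a -> atom b -> a <= b -> a = b.
Proof.
move=> A /andP[_ /forallP/(_ a)/implyP H]; rewrite le_eqVlt => /predU1P[//|/H].
by rewrite (negPf (atom_neq0 A)).
Qed.

Lemma join_irreducible_joins (x : L) (A : {set L}) :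
  join_irreducible x -> x = \join_(a in A) a -> x \in A.
Proof.
case/andP=> x0 /forallP irr.
elim: {A}#|A| {-2}A (leqnn #|A|) => [|n IH] A.
  rewrite leqn0 cards_eq0 => /eqP->.
  by rewrite big_set0 => /eqP; rewrite (negPf x0).
have [->|[a aA]] := set_0Vmem A.
  by rewrite big_set0 => _ /eqP; rewrite (negPf x0).
rewrite (cardsD1 a) aA ltnS (big_setD1 a aA) /= => le_n Ex.
have /forallP/(_ (\join_(b in A :\ a) b))/implyP := irr a.
move/(_ (introT eqP Ex)).
case/orP=> /eqP Ex'; first by rewrite Ex'.
by have := IH _ le_n Ex'; rewrite inE => /andP[].
Qed.

Lemma atom_join_irreducible a : atom a -> join_irreducible a.
Proof.
move=> A; rewrite /join_irreducible atom_neq0 //=.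
apply/forallP=> x; apply/forallP=> y; apply/implyP=> /eqP E.
have [le_ax|/(atom_meet A) ax0] := boolP (a <= x).
  by rewrite eq_le le_ax /= {1}E leUl.
have /predU1P[->|lt_xa] : (x == a) || (x < a) by rewrite -le_eqVlt E leUl.
  by rewrite eqxx.
have /andP[_ /forallP/(_ x)/implyP/(_ lt_xa)/eqP x0] := A.
by rewrite E x0 join0x eqxx orbT.
Qed.

Hypothesis atomL : atomistic L.

Lemma J_atomistic : J L = atoms.
Proof.
apply/setP=> x; rewrite !inE; apply/idP/idP; last exact: atom_join_irreducible.
move=> irr; have [A atA Ex] := atomL x.
by apply: atA; exact: join_irreducible_joins Ex.
Qed.

Definition atoms_below x : {set L} := [set a : L | atom a & a <= x].

Lemma atomistic_join x : x = \join_(a in atoms_below x) a.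
Proof.
apply/le_anti/andP; split; last by apply/joinsP=> a; rewrite inE => /andP[].
have [A atA Ex] := atomL x; rewrite {1}Ex; apply: le_joins.
by apply/subsetP=> a aA; rewrite inE atA //= Ex; exact: joins_sup.
Qed.

(** * Congruences of a finite atomistic lattice as removable sets of atoms *)

(** The sets of atoms that can be deleted from any join of atoms without
    losing an atom outside of them. *)
Definition removable S := forall p X,
  atom p -> p \notin S -> X \subset atoms ->
  p <= \join_(a in X) a -> p <= \join_(a in X :\: S) a.

Lemma removableU S T : removable S -> removable T -> removable (S :|: T).
Proof.
move=> rS rT p X atp; rewrite inE negb_or => /andP[pS pT] Xat le_pX.
rewrite -setDDl.
by apply: rT => //; [exact: subset_trans (subsetDl _ _) Xat | exact: rS].
Qed.

(** The atoms that [r] identifies with [\bot]. *)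
Definition collapsed (r : con L) : {set L} :=
  [set a : L | atom a & (a, \bot) \in (r : {set L * L})].

Lemma collapsed_sub_atoms r : collapsed r \subset atoms.
Proof. by apply/subsetP=> a; rewrite !inE => /andP[]. Qed.

Lemma con_joins (r : con L) (I : finType) (A : {set I}) (F G : I -> L) :
  (forall i, i \in A -> (F i, G i) \in (r : {set L * L})) ->
  (\join_(i in A) F i, \join_(i in A) G i) \in (r : {set L * L}).
Proof.
have /congruenceP[R _ _ _ Jo] := con_relP r => H.
by elim/big_ind2: _ => [|x1 x2 y1 y2|]; [exact: R | exact: Jo | exact: H].
Qed.

Lemma collapsed_removable r : removable (collapsed r).
Proof.
have /congruenceP[R S T M Jo] := con_relP r.
move=> p X atp pr Xat le_pX; set y := \join_(a in _) a.
apply: contraR pr => npy; rewrite inE atp /= -(atom_meet atp npy).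
have -> : (p, p `&` y) = (p `&` \join_(a in X) a, p `&` y).
  by rewrite (meet_l le_pX).
apply: M; first exact: R.
rewrite /y.
(* Pad the second join with [\bot] so that both joins range over [X]. *)
have -> : \join_(a in X :\: collapsed r) a
    = \join_(a in X) (if a \in collapsed r then \bot else a).
  by rewrite big_mkcond [RHS]big_mkcond; apply: eq_bigr => a _; rewrite in_setD;
     case: (a \in X) => //; case: (a \in collapsed r).
apply: con_joins => a _; case: ifP => [|_]; last exact: R.
by rewrite inE => /andP[].
Qed.

(** The pairs of elements above the same atoms, those of [S] being ignored. *)
Definition agree_off S : {set L * L} :=
  [set u | atoms_below u.1 :\: S == atoms_below u.2 :\: S].

Lemma agree_off_congruence S : removable S -> congruence (agree_off S).
Proof.
move=> rS.
have sub x y z t : atoms_below x :\: S = atoms_below y :\: S ->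
    atoms_below z :\: S = atoms_below t :\: S ->
    atoms_below (x `|` z) :\: S \subset atoms_below (y `|` t) :\: S.
  move=> Exy Ezt; apply/subsetP=> p; rewrite !in_setD => /andP[pS].
  rewrite pS !inE => /andP[atp le_p]; rewrite atp /=.
  have [Xx Xz] := (atomistic_join x, atomistic_join z).
  move: le_p; rewrite {1}Xx {1}Xz -joins_setU => /(rS _ _ atp pS).
  rewrite setDUl Exy Ezt -setDUl => H.
  have /H : atoms_below x :|: atoms_below z \subset atoms.
    by apply/subsetP=> a; rewrite !inE; case: (atom a).
  move=> /le_trans; apply; apply/joinsP=> a; rewrite !inE => /andP[_].
  by case/orP=> /andP[_ /le_trans]; apply; rewrite ?leUl ?leUr.
apply/congruenceP; split=> [x|x y|x y z|x y z t|x y z t]; rewrite !inE /=.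
- by [].
- by rewrite eq_sym.
- by move=> /eqP->.
- have EI u v : atoms_below (u `&` v) :\: S
      = (atoms_below u :\: S) :&: (atoms_below v :\: S).
    apply/setP=> a; rewrite !inE lexI.
    by case: (a \in S); case: (atom a) => //=; rewrite ?andbF.
  by rewrite !EI => /eqP-> /eqP->.
- by move=> /eqP E1 /eqP E2; rewrite eqEsubset !sub.
Qed.

(** The congruence collapsing exactly the atoms in the removable set [S]. *)
Definition con_of S (rS : removable S) : con L := Con (agree_off_congruence rS).

Lemma collapsed_con_of S (rS : removable S) :
  S \subset atoms -> collapsed (con_of rS) = S.
Proof.
move=> Sat; apply/setP=> a; rewrite !inE /=.
have -> : atoms_below \bot :\: S = set0.
  apply/setP=> b; rewrite !inE lex0; case: (boolP (atom b)); rewrite ?andbF //.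
  by move/atom_neq0/negPf->; rewrite !andbF.
rewrite setD_eq0; apply/andP/idP => [[ata /subsetP]|aS].
  by apply; rewrite inE ata lexx.
have ata : atom a by have := subsetP Sat a aS; rewrite inE.
split=> //; apply/subsetP=> b; rewrite inE => /andP[atb le_ba].
by rewrite (atom_le_eq atb ata le_ba).
Qed.

(** The congruences are ordered as the sets of atoms that they collapse. It
    suffices to see that [s] identifies [x] with its meet with [y] when [r]
    identifies [x] and [y]: an atom below [x] is either below [y], or disjoint
    from [y], hence collapsed by [r] and by [s]. *)
Lemma collapsed_le (r s : con L) :
  (r <= s) = (collapsed r \subset collapsed s).
Proof.
apply/idP/idP => [/subsetP rs|/subsetP rs]; apply/subsetP.
  by move=> a; rewrite !inE => /andP[-> /rs].
have /congruenceP[Rr Sr _ Mr _] := con_relP r.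
have /congruenceP[Rs Ss Ts _ Js] := con_relP s.
have meet_s x y : (x, y) \in (r : {set _}) -> (x, x `&` y) \in (s : {set _}).
  move=> rxy.
  have : (\join_(a in atoms_below x) a, \join_(a in atoms_below x) (a `&` y))
      \in (s : {set _}).
    apply: con_joins => a; rewrite inE => /andP[ata le_ax].
    have [le_ay|/(atom_meet ata) a0] := boolP (a <= y); first by rewrite meet_l.
    suff : a \in collapsed s by rewrite a0 inE => /andP[].
    apply: rs; rewrite inE ata -a0 -{1}(meet_l le_ax).
    exact: Mr.
  rewrite -atomistic_join => /Js/(_ (Rs (x `&` y))).
  rewrite meetKU [X in (_, X)]join_r //.
  apply/joinsP=> a; rewrite inE => /andP[_ le_ax]; exact: leI2.
move=> [x y] rxy; apply: Ts (meet_s _ _ rxy) _; rewrite meetC.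
by apply/Ss/meet_s/Sr.
Qed.

Lemma collapsed_inj : injective collapsed.
Proof. by move=> r s E; apply/le_anti; rewrite !collapsed_le E !subxx. Qed.
End Atoms.

(** * Order isomorphisms are lattice isomorphisms *)

Section OrderIso.
Local Open Scope order_scope.

Lemma lattice_iso_of_order (d d' : Order.disp_t) (L : latticeType d)
    (M : latticeType d') (g : M -> L) :
  {mono g : x y / x <= y} -> (forall y, exists x, g x = y) -> lattice_iso L M.
Proof.
move=> g_mono g_surj.
have ex y : exists x, g x == y by have [x <-] := g_surj y; exists x.
pose f y := xchoose (ex y).
have fK : cancel f g by move=> y; exact/eqP/(xchooseP (ex y)).
have gK : cancel g f by apply: inj_can_sym => //; exact: inc_inj.
have f_mono : {mono f : x y / x <= y} by move=> x y; rewrite -g_mono !fK.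
exists f; split; first by exists g.
- move=> x y; apply/le_anti; rewrite lexI !f_mono leIl leIr -g_mono fK.
  by rewrite lexI -!f_mono !gK leIl leIr.
- move=> x y; apply/le_anti; rewrite leUx !f_mono leUl leUr andbT -g_mono fK.
  by rewrite leUx -!f_mono !gK leUl leUr.
Qed.
End OrderIso.


(** * The lattice of pair-closed subsets of a finite relation *)

Section PairClosed.
Local Open Scope order_scope.
Context {Q : finType} (e : rel Q).
Implicit Types X Y : {set Q}.

(** The sets that contain [p] whenever they contain two distinct [e]-successors
    of [p]. The relation [e] is arbitrary here; it is meant to be the order of
    the congruences generated by the elements of [Q]. *)
Definition pair_closed X : bool :=
  [forall p, forall q in X, forall r in X,
     (q != r) && e p q && e p r ==> (p \in X)].

Lemma pair_closedP X :
  reflect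
    (forall p q r,
       q \in X -> r \in X -> q != r -> e p q -> e p r -> p \in X)
    (pair_closed X).
Proof.
apply: (iffP forallP) => [H p q r qX rX qr pq pr | H p].
  by have /forall_inP/(_ q qX)/forall_inP/(_ r rX) := H p; rewrite qr pq pr.
apply/forall_inP=> q qX; apply/forall_inP=> r rX.
apply/implyP=> /andP[/andP[qr pq] pr].
exact: H pq pr.
Qed.

Lemma pair_closed_bigcap (P : pred {set Q}) :
  (forall X, P X -> pair_closed X) -> pair_closed (\bigcap_(X | P X) X).
Proof.
move=> H; apply/pair_closedP=> p q r /bigcapP qX /bigcapP rX qr pq pr.
apply/bigcapP=> X PX; have /pair_closedP := H X PX; apply; last exact: pr.
- exact: qX PX.
- exact: rX PX.
- exact: qr.
- exact: pq.
Qed.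

Definition pair_closure X : {set Q} :=
  \bigcap_(Y : {set Q} | pair_closed Y && (X \subset Y)) Y.

Lemma pair_closureP X : pair_closed (pair_closure X).
Proof. by apply: pair_closed_bigcap => Y /andP[]. Qed.

Lemma pair_closure_sub X Y :
  pair_closed Y -> (pair_closure X \subset Y) = (X \subset Y).
Proof.
move=> clY; apply/idP/idP => [|XY]; last by apply: bigcap_inf; rewrite clY.
by apply: subset_trans; apply/bigcapsP=> Z /andP[].
Qed.

Lemma pair_closedI X Y :
  pair_closed X -> pair_closed Y -> pair_closed (X :&: Y).
Proof.
move=> /pair_closedP cX /pair_closedP cY; apply/pair_closedP=> p q r.
rewrite !inE => /andP[qX qY] /andP[rX rY] qr pq pr.
by rewrite (cX p q r) ?(cY p q r).
Qed.

Lemma pair_closed0 : pair_closed set0.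
Proof. by apply/pair_closedP=> p q r; rewrite inE. Qed.

Lemma pair_closedT : pair_closed setT.
Proof. by apply/pair_closedP=> p q r; rewrite inE. Qed.

Lemma pair_closed1 q : pair_closed [set q].
Proof.
by apply/pair_closedP=> p x y; rewrite !inE => /eqP-> /eqP->; rewrite eqxx.
Qed.

End PairClosed.

(** The lattice of pair-closed sets, ordered by inclusion. *)
Record closed_set (Q : finType) (e : rel Q) := ClosedSet {
  closed_set_val :> {set Q};
  closed_setP : pair_closed e closed_set_val
}.

HB.instance Definition _ (Q : finType) (e : rel Q) :=
  [isSub for @closed_set_val Q e].
HB.instance Definition _ (Q : finType) (e : rel Q) :=
  [Finite of closed_set e by <:].

Fact closed_set_display : Order.disp_t. Proof. exact: Order.Disp tt tt. Qed.

Section ClosedSetLattice.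
Local Open Scope order_scope.
Context {Q : finType} {e : rel Q}.
Implicit Types x y z : closed_set e.

Definition cs_le x y : bool := (x : {set Q}) \subset y.

Fact cs_le_refl : reflexive cs_le.
Proof. by move=> x; exact: subxx. Qed.
Fact cs_le_anti : antisymmetric cs_le.
Proof. by move=> x y; rewrite /cs_le -eqEsubset => /eqP/val_inj. Qed.
Fact cs_le_trans : transitive cs_le.
Proof. by move=> y x z; exact: subset_trans. Qed.

HB.instance Definition _ := Order.Le_isPOrder.Build closed_set_display
  (closed_set e) cs_le_refl cs_le_anti cs_le_trans.

Definition cs_meet x y : closed_set e :=
  ClosedSet (pair_closedI (closed_setP x) (closed_setP y)).
Definition cs_join x y : closed_set e :=
  ClosedSet (pair_closureP e ((x : {set Q}) :|: y)).

Fact cs_meetP x y z : (x <= cs_meet y z) = (x <= y) && (x <= z).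
Proof. exact: subsetI. Qed.
Fact cs_joinP x y z : (cs_join x y <= z) = (x <= z) && (y <= z).
Proof. by rewrite -subUset; apply: pair_closure_sub; exact: closed_setP. Qed.

HB.instance Definition _ := Order.POrder_MeetJoin_isLattice.Build
  closed_set_display (closed_set e) cs_meetP cs_joinP.

Fact cs_le0 x : ClosedSet (pair_closed0 e) <= x.
Proof. exact: sub0set. Qed.
Fact cs_le1 x : x <= ClosedSet (pair_closedT e).
Proof. exact: subsetT. Qed.

HB.instance Definition _ :=
  Order.hasBottom.Build closed_set_display (closed_set e) cs_le0.
HB.instance Definition _ :=
  Order.hasTop.Build closed_set_display (closed_set e) cs_le1.

(** The atoms of this lattice: the singletons. *)
Definition point (q : Q) : closed_set e := ClosedSet (pair_closed1 e q).

Lemma point_inj : injective point.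
Proof. by move=> q r /(congr1 val) /= /set1_inj. Qed.

Lemma point_le q x : (point q <= x) = (q \in (x : {set Q})).
Proof. exact: sub1set. Qed.

Lemma closed_set_neq0 x : x != \bot -> exists q, point q <= x.
Proof.
move=> nx; have [x0|[q qx]] := set_0Vmem (x : {set Q}).
  by case/eqP: nx; exact: val_inj.
by exists q; rewrite point_le.
Qed.

Lemma point_atom q : atom (point q).
Proof.
apply/andP; split.
  by rewrite lt0x; apply/eqP=> /(congr1 val)/setP/(_ q) /=; rewrite !inE eqxx.
apply/forallP=> x; apply/implyP=> lt_xq; apply: contraTT lt_xq.
case/closed_set_neq0=> r le_rx; apply/negP=> lt_xq.
have /ltW := le_lt_trans le_rx lt_xq.
rewrite point_le inE => /eqP rq; move: le_rx lt_xq; rewrite rq => le_qx.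
by move=> /(le_lt_trans le_qx); rewrite ltxx.
Qed.

Lemma atom_point x : atom x -> exists q, x = point q.
Proof.
move=> atx; have [q le_qx] := closed_set_neq0 (atom_neq0 atx).
by exists q; rewrite (atom_le_eq (point_atom q) atx le_qx).
Qed.

Lemma closed_set_atomistic : atomistic (closed_set e).
Proof.
move=> x; exists [set point q | q in (x : {set Q})].
  by move=> a /imsetP[q _ ->]; exact: point_atom.
apply/le_anti/andP; split; last first.
  by apply/joinsP=> a /imsetP[q qx ->]; rewrite point_le.
apply/subsetP=> q qx; rewrite -point_le.
apply: (@joins_sup _ _ _ (point q) _ id).
exact: imset_f.
Qed.

Lemma card_J_closed_set : #|J (closed_set e)| = #|Q|.
Proof.
rewrite (J_atomistic closed_set_atomistic) -cardsT -(card_imset _ point_inj).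
congr #|pred_of_set _|; apply/setP=> x; rewrite !inE.
apply/idP/imsetP=> [/atom_point[q ->]|[q _ ->]]; last exact: point_atom.
by exists q.
Qed.

Hypothesis e_third : forall p q, p != q -> e p q ->
  exists r, [/\ r != p, r != q & e p r].

(** Sets closed under [e]-predecessors. *)
Definition down_closed (S : {set Q}) := forall p q, e p q -> q \in S -> p \in S.

Lemma down_closed_removable (S : {set Q}) :
  down_closed S -> removable [set point q | q in S].
Proof.
(* It suffices that the join of the remaining points, together with [S], is
   closed: it then contains the join of [X]. *)
move=> dS p' X atp pS Xat; have [p Ep] := atom_point atp.
rewrite {}Ep (mem_imset _ _ point_inj) in pS *.
set u := \join_(a in X) a; set v := \join_(a in _) a.
have clY : pair_closed e ((v : {set Q}) :|: S).
  apply/pair_closedP=> x q r; rewrite !in_setU.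
  have [qS _ _ _ xq _|_] := boolP (q \in S).
    by rewrite (dS _ _ xq qS) orbT.
  have [rS _ _ _ _ xr|_] := boolP (r \in S).
    by rewrite (dS _ _ xr rS) orbT.
  rewrite !orbF => qv rv qr xq xr.
  by have /pair_closedP/(_ x q r qv rv qr xq xr)-> := closed_setP v.
have le_uY : u <= ClosedSet clY.
  apply/joinsP=> a aX.
  have [q Ea] : exists q, a = point q.
    by apply: atom_point; have := subsetP Xat a aX; rewrite inE.
  rewrite {}Ea in aX *; rewrite point_le in_setU.
  have [|qS] := boolP (q \in S); first by rewrite orbT.
  rewrite orbF -point_le; apply: (@joins_sup _ _ _ (point q) _ id).
  rewrite inE aX andbT.
  by rewrite (mem_imset _ _ point_inj).
move=> /le_trans/(_ le_uY); rewrite !point_le in_setU.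
by rewrite (negPf pS) orbF.
Qed.

Lemma removable_down_closed (S : {set closed_set e}) :
  removable S -> down_closed [set q | point q \in S].
Proof.
move=> rS p q pq; rewrite !inE => qS.
have [->//|npq] := eqVneq p q.
have [r [rp rq pr]] := e_third npq pq; apply: contraT => pS.
have /(rS _ _ (point_atom p) pS) : [set point q; point r] \subset atoms.
  by apply/subsetP=> a; rewrite !inE => /orP[]/eqP->; exact: point_atom.
have sup x : x \in [set point q; point r] ->
    x <= \join_(a in [set point q; point r]) a.
  by move=> xX; exact: joins_sup.
have -> : point p <= \join_(a in [set point q; point r]) a.
  rewrite point_le.
  have /pair_closedP/(_ p q r) :=
    closed_setP (\join_(a in [set point q; point r]) a).
  by apply; rewrite -?point_le ?sup ?inE ?eqxx ?orbT // eq_sym.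
move/(_ isT) => le_p.
have /(le_trans le_p) : \join_(a in [set point q; point r] :\: S) a <= point r.
  apply/joinsP=> a; rewrite !inE => /andP[aS /orP[]/eqP Ea].
    by rewrite Ea qS in aS.
  by rewrite Ea.
by rewrite point_le inE eq_sym (negPf rp).
Qed.

End ClosedSetLattice.

(** * Representing a distributive lattice by a multiset of join-irreducibles *)

Section Representation.
Local Open Scope order_scope.
Context {d : Order.disp_t}.

Lemma join_irreducibles_join (D : finTBLatticeType d) (x : D) :
  x = \join_(j in J D | j <= x) j.
Proof.
elim: {x}#|[set y | y < x]| {-2}x (leqnn #|[set y | y < x]|) => [|n IH] x le_n.
  apply/le_anti/andP; split; last by apply/joinsP=> j /andP[].
  have [->|x0] := eqVneq x \bot; first exact: le0x.
  move: le_n; rewrite leqn0 cards_eq0 => /eqP/setP/(_ \bot).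
  by rewrite !inE lt0x x0.
apply/le_anti/andP; split; last by apply/joinsP=> j /andP[].
have [->|x0] := eqVneq x \bot; first exact: le0x.
have [xJ|] := boolP (x \in J D).
  by apply: (@joins_sup _ _ _ x _ id); rewrite xJ lexx.
rewrite inE /join_irreducible x0 /= => /forallPn[a /forallPn[b]].
rewrite negb_imply negb_or => /and3P[/eqP Ex xa xb].
have step c : c < x -> c <= \join_(j in J D | j <= x) j.
  move=> lt_cx; rewrite {1}(IH c); last first.
    rewrite -ltnS; apply: leq_trans le_n; apply: proper_card.
    apply/properP; split.
      by apply/subsetP=> y; rewrite !inE => /lt_trans; apply.
    by exists c; rewrite inE ?ltxx.
  apply/joinsP=> j /andP[jJ le_jc]; apply: (@joins_sup _ _ _ j _ id).
  by rewrite jJ (le_trans le_jc (ltW lt_cx)).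
by rewrite {1}Ex leUx !step // lt_def ?xa ?xb Ex ?leUl ?leUr.
Qed.

Context {D : finTBDistrLatticeType d}.

Lemma join_irreducible_prime (j : D) (I : finType) (A : {set I}) (F : I -> D) :
  j \in J D -> j <= \join_(i in A) F i -> exists2 i, i \in A & j <= F i.
Proof.
rewrite inE => /andP[j0 /forallP irr].
elim/big_ind: _ => [|x y IHx IHy|i iA le_ji]; last by exists i.
  by rewrite lex0 (negPf j0).
move=> /meet_l; rewrite meetUr => Ej.
have /forallP/(_ (j `&` y))/implyP := irr (j `&` x).
by rewrite Ej eqxx ![j == _]eq_sym !eq_meetl => /(_ isT)/orP[/IHx|/IHy].
Qed.

(** [Q] with [rep] encodes a multiset with support [J D]: each [j] is counted
    once for each [q] such that [rep q = j]. *)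
Context {Q : finType} (rep : Q -> D).
Hypothesis rep_J : forall q, rep q \in J D.
Hypothesis J_rep : forall j, j \in J D -> exists q, rep q = j.
Hypothesis rep_third : forall p q, p != q -> rep p <= rep q ->
  exists r, [/\ r != p, r != q & rep p <= rep r].

Let e : rel Q := fun p q => rep p <= rep q.

Lemma con_closed_set_iso : lattice_iso (con (closed_set e)) D.
Proof.
have atomL := @closed_set_atomistic Q e.
have down x : down_closed (e := e) [set q | rep q <= x].
  by move=> p q pq; rewrite !inE; exact: le_trans.
pose g x := con_of atomL (down_closed_removable (down x)).
have gE x q : (@point _ e q \in collapsed (g x)) = (rep q <= x).
  rewrite collapsed_con_of ?(mem_imset _ _ (@point_inj _ _)) ?inE //.
  by apply/subsetP=> a /imsetP[p _ ->]; rewrite inE point_atom.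
have gP x y : reflect (forall q, rep q <= x -> rep q <= y) (g x <= g y).
  rewrite collapsed_le //; apply: (iffP subsetP) => [H q|H a].
    by rewrite -!gE => /H.
  move=> aS; have := subsetP (collapsed_sub_atoms (g x)) a aS; rewrite inE.
  by case/atom_point=> q Ea; move: aS; rewrite Ea !gE; exact: H.
(* The inverse of [g] maps a congruence to the join of the representatives of
   the points that it collapses. *)
apply: (@lattice_iso_of_order _ _ _ _ g) => [x y|r].
  apply/gP/idP => [H|le_xy q /le_trans]; last exact.
  rewrite [x]join_irreducibles_join; apply/joinsP=> j /andP[/J_rep[q <-]].
  exact: H.
have dS := removable_down_closed rep_third (@collapsed_removable _ _ r).
set S := [set q | _] in dS.
exists (\join_(q in S) rep q); apply: (collapsed_inj atomL).
apply/setP=> a; have [ata|nata] := boolP (atom a); last first.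
  by rewrite !inE (negPf nata).
have [q ->] := atom_point ata; rewrite gE.
have -> : (@point _ e q \in collapsed r) = (q \in S) by rewrite [RHS]inE.
apply/idP/idP => [/(join_irreducible_prime (rep_J q))[p pS le_qp]|qS].
  exact: dS le_qp pS.
exact: joins_sup.
Qed.

End Representation.

(** * The number of copies *)

Section Copies.
Local Open Scope order_scope.
Context {d : Order.disp_t} {T : finPOrderType d} (P : {set T}).
Implicit Types p m j : T.

(** [m] is the only element of [P] strictly above [p]; it is then a maximal
    element of [P]. *)
Definition only_above p m : bool :=
  [&& p \in P, p != m & [set x in P | p <= x] == [set p; m]].

(** The number of [p] above which [m] is alone. *)
Definition nb_below m : nat := #|[set p | only_above p m]|.

(** The multiplicity of [j]. *)
Definition copies j : nat :=
  if (2 <= nb_below j)%N then 3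
  else if [exists m, only_above j m && (nb_below m == 1%N)] then 2 else 1.

Lemma only_aboveP p m : only_above p m ->
  [/\ p \in P, m \in P, p != m, p <= m
    & forall x, x \in P -> p <= x -> x = p \/ x = m].
Proof.
case/and3P=> pP pm /eqP E.
have /setIdP[mP le_pm] : m \in [set x in P | p <= x].
  by rewrite E !inE eqxx orbT.
split=> // x xP le_px; have : x \in [set x in P | p <= x] by rewrite inE xP.
by rewrite E !inE => /orP[]/eqP; [left|right].
Qed.

Lemma only_above_not_below p m : only_above p m -> nb_below p = 0%N.
Proof.
case/only_aboveP=> pP mP pm le_pm _; apply: eq_card0 => q; rewrite inE.
apply/negP=> /only_aboveP[qP _ qp le_qp H].
have [E|E] := H m mP (le_trans le_qp le_pm); last by rewrite E eqxx in pm.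
by case/eqP: qp; apply/le_anti; rewrite le_qp -E le_pm.
Qed.

Lemma only_above_uniq p m m' : only_above p m -> only_above p m' -> m = m'.
Proof.
case/only_aboveP=> _ _ _ _ H /only_aboveP[_ mP pm le_pm _].
by have [E|//] := H _ mP le_pm; rewrite E eqxx in pm.
Qed.

(** Both [m] with [nb_below m > 0] and the elements below it in the sense of
    [only_above] are charged to pay for the extra copies that [m] causes:
    [min (nb_below m) 2] of them, with
    [3 * min c 2 <= 2 * ((0 < c) + c)] for every [c]. The bound follows as no
    element is charged twice. *)
Lemma sum_copies : (3 * \sum_(j in P) copies j <= 5 * #|P|)%N.
Proof.
pose w p m : nat := only_above p m.
pose u p : nat := [exists m, only_above p m && (nb_below m == 1%N)].
have nbE m : nb_below m = \sum_p w p m.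
  rewrite /nb_below -sum1_card big_mkcond; apply: eq_bigr => p _.
  by rewrite inE /w; case: (only_above _ _).
have copiesE j : (3 * copies j <= 3 + (6 * (2 <= nb_below j) + 3 * u j))%N.
  by rewrite /copies /u; case: (2 <= nb_below j)%N; case: [exists m, _].
have u_le : (\sum_p u p <= \sum_m nb_below m * (nb_below m == 1))%N.
  have -> : (\sum_m nb_below m * (nb_below m == 1)
      = \sum_m \sum_p w p m * (nb_below m == 1))%N.
    by apply: eq_bigr => m _; rewrite [in RHS]/= -big_distrl /= -nbE.
  rewrite exchange_big; apply: leq_sum => p _; rewrite /u.
  case: existsP => [[m /andP[pm nm]]|//].
  by rewrite (bigD1 m) //= /w pm nm.
have charge j : ((0 < nb_below j) + \sum_m w j m <= (j \in P))%N.
  have [m jm|no] := pickP (only_above j).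
    rewrite (only_above_not_below jm) (bigD1 m) //= big1 => [|m' m'm].
      by have [-> _ _ _ _] := only_aboveP jm; rewrite /w jm.
    by apply/eqP; rewrite eqb0; apply: contra m'm => /(only_above_uniq jm)->.
  rewrite big1 => [|m _]; last by rewrite /w no.
  rewrite addn0; case: posnP => // /card_gt0P[p].
  by rewrite inE => /only_aboveP[_ ->].
rewrite big_distrr /= (leq_trans (leq_sum _ (fun j _ => copiesE j))) //.
rewrite big_split sum_nat_const /=.
rewrite (_ : 5 * #|P| = #|P| * 3 + 2 * #|P|)%N; last by lia.
rewrite leq_add2l.
apply: (@leq_trans (\sum_m (6 * (2 <= nb_below m)
    + 3 * (nb_below m * (nb_below m == 1))))%N).
  rewrite big_split [leqRHS]big_split /= -!big_distrr /=; apply: leq_add.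
    by rewrite leq_mul2l /= [leqRHS](bigID (mem P)) leq_addr.
  rewrite leq_mul2l /=; apply: leq_trans u_le.
  by rewrite [leqRHS](bigID (mem P)) leq_addr.
apply: (@leq_trans (\sum_m 2 * ((0 < nb_below m) + nb_below m))%N).
  by apply: leq_sum => m _; case: (nb_below m) => [|[|n]] //=; lia.
rewrite -big_distrr leq_mul2l /= big_split /=.
under [X in (_ + X)%N]eq_bigr => m _ do rewrite nbE.
rewrite exchange_big -big_split /= -sum1_card [leqRHS]big_mkcond.
by apply: leq_sum => j _; have := charge j; case: (j \in P).
Qed.

Lemma copies_gt0 j : (0 < copies j)%N.
Proof. by rewrite /copies; case: ifP => // _; case: ifP. Qed.

Lemma copies_le3 j : (copies j <= 3)%N.
Proof. by rewrite /copies; case: ifP => // _; case: ifP. Qed.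

(** Among the copies, whenever [(j', i')] is above [(j, i)] and differs from it,
    there is a third copy [(k, l)] above [(j, i)]. *)
Lemma copies_third j j' (i i' : nat) :
  j \in P -> j' \in P -> (i < copies j)%N -> (i' < copies j')%N ->
  (j, i) != (j', i') -> j <= j' ->
  exists k (l : nat), [/\ k \in P, (l < copies k)%N,
    (k, l) != (j, i), (k, l) != (j', i') & j <= k].
Proof.
have third a b : exists2 l : nat, (l < 3)%N & (l != a) && (l != b).
  have [?|?] := boolP ((0%N != a) && (0%N != b)); first by exists 0.
  have [?|?] := boolP ((1%N != a) && (1%N != b)); first by exists 1%N.
  by exists 2 => //; lia.
move=> jP j'P ij ij' ne le_jj'.
have [Ej|nj] := eqVneq j j'.
  rewrite -{}Ej xpair_eqE eqxx /= in ne ij' *.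
  move: ij ij'; rewrite {1 2}/copies.
  case: ifP => [n2 _ _|n2].
    have [l l3 /andP[li li']] := third i i'.
    by exists j, l; rewrite /copies n2 !xpair_eqE eqxx li li'.
  case: ifP => [/existsP[m /andP[jm _]] _ _|_]; last by lia.
  have [_ mP njm le_jm _] := only_aboveP jm.
  by exists m, 0%N; rewrite mP copies_gt0 !xpair_eqE !(eq_sym m) (negPf njm).
have [x|no] := pickP [pred x in P | [&& j <= x, x != j & x != j']].
  case/and4P=> xP le_jx xj xj'; exists x, 0%N.
  by rewrite copies_gt0 !xpair_eqE (negPf xj) (negPf xj').
have jj' : only_above j j'.
  apply/and3P; split=> //; apply/eqP/setP=> x; rewrite !inE.
  have /= := no x; case: eqVneq => [->|_]; first by rewrite jP lexx.
  case: eqVneq => [->|_]; first by rewrite j'P le_jj'.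
  by rewrite !andbT.
have [n2|n1] := boolP (2 <= nb_below j')%N.
  have [l l3 /andP[_ li']] := third 0%N i'.
  by exists j', l; rewrite /copies n2 !xpair_eqE eqxx li' (eq_sym j') (negPf nj).
have n1' : nb_below j' == 1%N.
  rewrite eqn_leq leqNgt n1 /=; apply/card_gt0P; exists j; by rewrite inE.
have cj : copies j = 2%N.
  rewrite /copies (only_above_not_below jj') /=.
  by rewrite (_ : [exists m, _]) //; apply/existsP; exists j'; rewrite jj' n1'.
exists j, (i == 0%N); rewrite cj !xpair_eqE eqxx (negPf nj); split=> //.
  by case: (i == 0%N).
by case: i ij {ne}=> [|i].
Qed.
End Copies.

(** * The upper bound *)

Section UpperBound.
Local Open Scope order_scope.
Context {d : Order.disp_t} (D : finTBDistrLatticeType d).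

(** The pairs of an element [j] of [J D] and of an index below [copies j]; the
    latter is at most 3. *)
Definition copy : finType :=
  {x : D * 'I_3 | (x.1 \in J D) && (x.2 < copies (J D) x.1)%N}.

Definition copy_rep (q : copy) : D := (val q).1.

Definition copy_lattice : finTBLatticeType closed_set_display :=
  closed_set (fun p q : copy => copy_rep p <= copy_rep q).

Lemma copy_exists j (i : nat) : j \in J D -> (i < copies (J D) j)%N ->
  exists2 q : copy, copy_rep q = j & (val q).2 = i :> nat.
Proof.
move=> jJ ij; have i3 := leq_trans ij (copies_le3 (J D) j).
have jiP : ((j, Ordinal i3).1 \in J D)
    && ((j, Ordinal i3).2 < copies (J D) (j, Ordinal i3).1)%N by rewrite jJ.
by exists (exist (fun x : D * 'I_3 =>
  (x.1 \in J D) && (x.2 < copies (J D) x.1)%N) (j, Ordinal i3) jiP).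
Qed.

Lemma copy_lattice_iso : lattice_iso (con copy_lattice) D.
Proof.
apply: con_closed_set_iso => [q|j jJ|p q pq le_pq].
- by case/andP: (valP q).
- by have [q] := copy_exists jJ (copies_gt0 (J D) j); exists q.
case/andP: (valP p) (valP q) => pJ pc /andP[qJ qc].
have copy_ne (p1 p2 : copy) :
    (copy_rep p1, (val p1).2 : nat) != (copy_rep p2, (val p2).2 : nat) ->
    p1 != p2.
  by apply: contraNneq => ->.
have ne : (copy_rep p, (val p).2 : nat) != (copy_rep q, (val q).2 : nat).
  apply: contra pq; rewrite xpair_eqE => /andP[/eqP E1 /eqP/val_inj E2].
  apply/eqP/val_inj; move: E1 E2; rewrite /copy_rep.
  by case: (val p) (val q) => [a b] [a' b'] /= -> ->.
have [k [l [kJ lk nep neq le_pk]]] := copies_third pJ qJ pc qc ne le_pq.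
have [r Ek El] := copy_exists kJ lk.
by exists r; rewrite Ek; split=> //; apply: copy_ne; rewrite Ek El.
Qed.

Lemma card_copy : #|copy| = \sum_(j in J D) copies (J D) j.
Proof.
rewrite card_sig -sum1_card.
rewrite (eq_bigl (fun x : D * 'I_3 =>
  (x.1 \in J D) && (x.2 < copies (J D) x.1)%N)) //.
rewrite -(pair_big_dep (mem (J D))
  (fun j (i : 'I_3) => (i < copies (J D) j)%N) (fun _ _ => 1%N)) /=.
apply: eq_bigr => j _; rewrite (big_ord_narrow (copies_le3 (J D) j)).
by rewrite sum1_card card_ord.
Qed.

End UpperBound.

(** * The lower bound *)

Section LowerBound.
Local Open Scope order_scope.
Context {d : Order.disp_t} {L : finTBLatticeType d}.
Hypothesis atomL : atomistic L.

(** Deleting [S] from a join above [p] of atoms other than [p] leaves at most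
    one atom, which is not above [p]; so [p] only lies below the joins of atoms
    to which it belongs. *)
Lemma removable_prime (S : {set L}) p : removable S -> atom p -> p \notin S ->
  (#|atoms :\: S| <= 2)%N -> removable (atoms :\ p).
Proof.
move=> rS atp pS c2 p' X atp'; rewrite !inE atp' andbT negbK.
move=> /eqP-> Xat le_pX.
suff pX : p \in X by apply: (@joins_sup _ _ _ p _ id); rewrite !inE eqxx pX.
apply: contraT => pX; have le_p := rS _ _ atp pS Xat le_pX.
have c1 : (#|X :\: S| <= 1)%N.
  rewrite -ltnS; apply: leq_trans c2; apply: proper_card; apply/properP.
  by split; [exact: setSD | exists p; rewrite !inE ?atp ?pS ?(negPf pX) ?andbF].
have [X0|[t tX]] := set_0Vmem (X :\: S).
  by move: le_p; rewrite X0 big_set0 lex0 (negPf (atom_neq0 atp)).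
have Et : X :\: S = [set t].
  by apply/esym/eqP; rewrite eqEcard sub1set tX cards1.
have tX' : t \in X by move: tX; rewrite inE => /andP[].
have att : atom t by have := subsetP Xat t tX'; rewrite inE.
move: le_p; rewrite Et big_set1 => /(atom_le_eq atp att) E.
by rewrite E tX' in pX.
Qed.

Lemma collapsed_join (r s : con L) :
  collapsed (r `|` s) = collapsed r :|: collapsed s.
Proof.
apply/eqP; rewrite eqEsubset subUset -!collapsed_le // leUl leUr !andbT.
have rem := removableU (@collapsed_removable _ _ r)
  (@collapsed_removable _ _ s).
have sub : collapsed r :|: collapsed s \subset atoms.
  by rewrite subUset !collapsed_sub_atoms.
rewrite -(collapsed_con_of atomL rem sub) -collapsed_le // leUx.
by rewrite !collapsed_le // collapsed_con_of // subsetUl subsetUr.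
Qed.

Lemma collapsed0 : collapsed (\bot : con L) = set0.
Proof.
apply/setP=> a; rewrite !inE /=; apply/negP=> /andP[/atom_neq0 a0].
by rewrite (negPf a0).
Qed.

Lemma collapsedT : collapsed (\top : con L) = atoms.
Proof. by apply/setP=> a; rewrite !inE andbT. Qed.

Lemma card_atoms_peaked (a b : con L) :
  a `&` b = \bot -> a != \bot -> b != \bot -> a `|` b != \top ->
  (forall r : con L, r <= a `|` b \/ r = \top) -> (5 <= #|@atoms d L|)%N.
Proof.
move=> ab0 a0 b0 abT cover.
pose A := collapsed a; pose B := collapsed b.
pose T : {set L} := atoms :\: (A :|: B).
have AB0 : A :&: B = set0.
  apply/setP=> x; rewrite -collapsed0 -ab0 !inE.
  by case: (atom x).
have nonempty (r : con L) : r != \bot -> (0 < #|collapsed r|)%N.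
  rewrite card_gt0; apply: contra => /eqP r0.
  by rewrite -lex0 collapsed_le // r0 sub0set.
have T_gt0 : (0 < #|T|)%N.
  rewrite card_gt0; apply: contra abT; rewrite setD_eq0 => sub.
  by rewrite -le1x collapsed_le // collapsedT collapsed_join.
have cA : #|A :|: B| = (#|A| + #|B|)%N by rewrite cardsU AB0 cards0 subn0.
have sAB : A :|: B \subset atoms by rewrite subUset !collapsed_sub_atoms.
have cT : #|@atoms d L| = (#|A| + #|B| + #|T|)%N.
  by rewrite -cA -(cardsID (A :|: B) atoms) (setIidPr sAB).
(* The congruence collapsing all atoms but [p] is below the join of [a] and
   [b]. *)
have key S p : removable S -> p \in (atoms : {set L}) -> p \notin S ->
    (#|atoms :\: S| <= 2)%N -> T \subset [set p].
  move=> rS; rewrite inE => atp pS /(removable_prime rS atp pS) rp.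
  have := cover (con_of atomL rp); rewrite collapsed_le // collapsed_join.
  rewrite collapsed_con_of ?subsetDl //; case=> [sub|/(congr1 collapsed)].
    apply/subsetP=> t; rewrite in_setD in_set1 => /andP[tAB tat].
    apply: contraNT tAB => tp; apply: (subsetP sub).
    by rewrite in_setD1 tp tat.
  rewrite collapsedT collapsed_con_of ?subsetDl // => /setP/(_ p).
  by rewrite !inE eqxx atp.
have half (r s : con L) : r != \bot -> collapsed r :&: collapsed s = set0 ->
    collapsed r :|: collapsed s = A :|: B -> (3 <= #|collapsed r| + #|T|)%N.
  move=> /nonempty/card_gt0P[p pr] rs0 rsAB; rewrite leqNgt; apply/negP=> c2.
  have pat := subsetP (collapsed_sub_atoms r) p pr.
  have ps : p \notin collapsed s.
    by apply/negP=> ps; have := in_set0 p; rewrite -rs0 inE pr ps.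
  have /card_gt0P[t tT] := T_gt0.
  have /subsetP/(_ t tT) : T \subset [set p].
    apply: (key (collapsed s)) => //; first exact: collapsed_removable.
    rewrite -ltnS; apply: leq_ltn_trans c2.
    apply: leq_trans (leq_of_leqif (leq_card_setU _ _)).
    apply/subset_leq_card/subsetP=> x; rewrite in_setD => /andP[xs xat].
    by rewrite in_setU in_setD -rsAB in_setU xat (negPf xs) orbF andbT orbN.
  rewrite inE => /eqP tp; move: tT.
  by rewrite tp in_setD -rsAB in_setU pr.
have T_ne2 : #|T| != 2.
  apply/negP=> /eqP c2; have /card_gt0P[t tT] := T_gt0.
  have := tT; rewrite in_setD => /andP[tAB tat].
  have /subset_leq_card : T \subset [set t].
    apply: (key (A :|: B)) => //; last by rewrite -/T c2.
    by apply: removableU; exact: collapsed_removable.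
  by rewrite c2 cards1.
have := half a b a0 AB0 erefl.
have := half b a b0; rewrite setIC [X in _ -> X = _ -> _]setUC => /(_ AB0 erefl).
rewrite -/A -/B cT; move: T_gt0 T_ne2 (nonempty a a0) (nonempty b b0).
rewrite -/A -/B; lia.
Qed.

End LowerBound.

(** The square [bool * bool] with a new top element [None]. *)
Definition peaked_square := option (bool * bool).
HB.instance Definition _ := Finite.on peaked_square.

Fact peaked_square_display : Order.disp_t. Proof. exact: Order.Disp tt tt. Qed.

Section PeakedSquare.
Local Open Scope order_scope.
Implicit Types x y z : peaked_square.

Definition ps_meet x y : peaked_square :=
  match x, y with
  | None, _ => y
  | _, None => x
  | Some a, Some b => Some (a.1 && b.1, a.2 && b.2)
  end.

Definition ps_join x y : peaked_square :=
  match x, y with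
  | Some a, Some b => Some (a.1 || b.1, a.2 || b.2)
  | _, _ => None
  end.

Fact ps_meetC : commutative ps_meet.
Proof. by do 2![case=> [[[] []]|]]. Qed.
Fact ps_joinC : commutative ps_join.
Proof. by do 2![case=> [[[] []]|]]. Qed.
Fact ps_meetA : associative ps_meet.
Proof. by do 3![case=> [[[] []]|]]. Qed.
Fact ps_joinA : associative ps_join.
Proof. by do 3![case=> [[[] []]|]]. Qed.
Fact ps_joinKI y x : ps_meet x (ps_join x y) = x.
Proof. by move: y x; do 2![case=> [[[] []]|]]. Qed.
Fact ps_meetKU y x : ps_join x (ps_meet x y) = x.
Proof. by move: y x; do 2![case=> [[[] []]|]]. Qed.
Fact ps_meetUl : left_distributive ps_meet ps_join.
Proof. by do 3![case=> [[[] []]|]]. Qed.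
Fact ps_meetxx : idempotent_op ps_meet.
Proof. by case=> [[[] []]|]. Qed.

HB.instance Definition _ := Order.isMeetJoinDistrLattice.Build
  peaked_square_display peaked_square
  (fun _ _ => erefl) (fun _ _ => erefl) ps_meetC ps_joinC ps_meetA ps_joinA
  ps_joinKI ps_meetKU ps_meetUl ps_meetxx.

Fact ps_le0 x : (Some (false, false) : peaked_square) <= x.
Proof. by case: x => [[[] []]|]. Qed.
Fact ps_le1 x : x <= (None : peaked_square).
Proof. by case: x => [[[] []]|]. Qed.

HB.instance Definition _ :=
  Order.hasBottom.Build peaked_square_display peaked_square ps_le0.
HB.instance Definition _ :=
  Order.hasTop.Build peaked_square_display peaked_square ps_le1.

Lemma card_J_peaked_square : (#|J peaked_square| <= 3)%N.
Proof.
pose s : seq peaked_square := [:: Some (true, false); Some (false, true); None].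
apply: leq_trans (card_size s); apply/subset_leq_card/subsetP.
case=> [[[] []]|] //; rewrite inE => /andP[] //.
by move=> _ /forallP/(_ (Some (true, false)))/forallP/(_ (Some (false, true))).
Qed.

Lemma card_J_of_peaked_con (d : Order.disp_t) (L : finTBLatticeType d) :
  atomistic L -> lattice_iso (con L) peaked_square -> (5 <= #|J L|)%N.
Proof.
move=> atomL [f [[g fK gK] fI fU]]; rewrite J_atomistic //.
have f_mono : {mono f : x y / x <= y}.
  by move=> x y; rewrite !leEmeet -fI (can_eq fK).
have f0 : f \bot = \bot by apply/eqP; rewrite -lex0 -[X in _ <= X]gK f_mono le0x.
have f1 : f \top = \top by apply/eqP; rewrite -le1x -[X in X <= _]gK f_mono lex1.
pose a : peaked_square := Some (true, false).
pose b : peaked_square := Some (false, true).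
apply: (@card_atoms_peaked _ _ atomL (g a) (g b)).
- by apply: (can_inj fK); rewrite fI !gK f0.
- by rewrite -(can_eq fK) gK f0.
- by rewrite -(can_eq fK) gK f0.
- by rewrite -(can_eq fK) fU !gK f1.
move=> r; rewrite -f_mono fU !gK.
case E: (f r) => [[[] []]|]; try by left.
by right; apply: (can_inj fK); rewrite f1.
Qed.
End PeakedSquare.

Local Open Scope ring_scope.

Lemma ratio_lt (R : realFieldType) (k : R) (m n : nat) :
  k < 5%:R / 3%:R -> (m <= 3)%N -> (5 <= n)%N -> ~ (n%:R <= k * m%:R).
Proof.
rewrite -(ler_nat R) -[(5 <= n)%N](ler_nat R) => lt_k m3 n5.
have m0 : 0 <= m%:R :> R by exact: ler0n.
by have [k0|k0] := lerP k 0; nra.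
Qed.

Theorem corollary5p4 (R : realType) :
  (forall (d : Order.disp_t) (D : finTBDistrLatticeType d),
     exists (d' : Order.disp_t) (L : finTBLatticeType d'),
       [/\ atomistic L,
           lattice_iso (con L) D,
           (#|J D| <= #|J L|)%N
         & #|J L|%:R <= (5%:R / 3%:R) * #|J D|%:R :> R])
  /\
  (forall k : R, k < 5%:R / 3%:R ->
     exists (d : Order.disp_t) (D : finTBDistrLatticeType d),
       forall (d' : Order.disp_t) (L : finTBLatticeType d'),
         atomistic L -> lattice_iso (con L) D ->
         ~ (#|J L|%:R <= k * #|J D|%:R)).
Proof.
split=> [d D | k lt_k].
  exists closed_set_display, (copy_lattice D).
  have cJ : #|J (copy_lattice D)| = (\sum_(j in J D) copies (J D) j)%N.
    by rewrite card_J_closed_set card_copy.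
  split; [exact: closed_set_atomistic | exact: copy_lattice_iso | |].
    by rewrite cJ -sum1_card; apply: leq_sum => j _; exact: copies_gt0.
  have := sum_copies (J D); rewrite -cJ -(ler_nat R) !natrM.
  lra.
exists peaked_square_display, peaked_square => d L atomL isoL.
exact: ratio_lt lt_k card_J_peaked_square (card_J_of_peaked_con atomL isoL).
Qed.
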